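(* Let $X$ be a Tychonoff space. Then $X$ is Menger at infinity if and only if both of the following hold: (i) $X$ is of countable type; and (ii) for every sequence $(K_n)_{n \in \omega}$ of compact subsets of $X$ and every family $(F_p^n)_{n,p \in \omega}$ of subsets of $X$ such that, for each $n \in \omega$, $(F_p^n)_{p \in \omega}$ is a decreasing (in $p$) closed net at $K_n$ in $X$, there is a function $f: \omega \to \omega$ such that $K = \bigcap_{n \in \omega} F_{f(n)}^n$ is compact and $\left(\bigcap_{k \leq n} F_{f(k)}^k\right)_{n \in \omega}$ is a closed net at $K$ in $X$.
   Context: Tychonoff spaces are Hausdorff, and $\beta X$ denotes the Čech–Stone compactification of $X$. A space $Z$ is Menger if for every sequence $(\mathcal{U}_n)_{n<\omega}$ of open covers of $Z$ there are finite sets $\mathcal{V}_n \subseteq \mathcal{U}_n$ such that $\bigcup_{n<\omega} \mathcal{V}_n$ covers $Z$. A Tychonoff space $X$ is Menger at infinity if $\beta X \setminus X$ is Menger. A space $X$ is of countable type if every compact subset of $X$ is contained in a compact subset $Q$ of $X$ of countable character in $X$, i.e. there is a countable family of open sets containing $Q$ such that every open set containing $Q$ contains a member of the family. For $K \subset X$, a family $\mathcal{F}$ is a closed net at $K$ (in $X$) if each $F \in \mathcal{F}$ is a closed subset of $X$ with $K \subset F$, and for every open $A \subset X$ with $K \subset A$ there is $F \in \mathcal{F}$ with $F \subset A$. *)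

(* Defs.v *)
From HB Require Import structures.
From mathcomp Require Import all_boot all_order all_algebra.
From mathcomp Require Import all_classical all_reals all_analysis.
Import numFieldNormedType.Exports.

Set Implicit Arguments.
Unset Strict Implicit.
Unset Printing Implicit Defensive.

Local Open Scope classical_set_scope.
Local Open Scope ring_scope.

Definition tychonoff_space (X : topologicalType) : Prop :=
  hausdorff_space X /\ completely_regular_space X.

Section CechStone.
Variables (R : realType) (X : topologicalType).

Definition unit_fun : Type :=
  {f : X -> R | continuous f /\ range f `<=` `[0, 1]}.

Definition stone_cech_eval (x : X) : {ptws unit_fun -> R} :=
  fun f => sval f x.

(* The closure of the image of X under evaluation at all continuous maps
   X -> [0, 1]. It is taken in R ^ unit_fun, in which the Tychonoff cube
   [0, 1] ^ unit_fun is closed, so it is the closure in the cube. *)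
Definition stone_cech : set {ptws unit_fun -> R} :=
  closure (range stone_cech_eval).

(* beta X \ X, where X is identified with its image. *)
Definition stone_cech_remainder : set {ptws unit_fun -> R} :=
  stone_cech `\` range stone_cech_eval.

End CechStone.

Arguments stone_cech : clear implicits.
Arguments stone_cech_remainder : clear implicits.

Definition open_cover (Z : topologicalType) (U : set (set Z)) : Prop :=
  U `<=` open /\ \bigcup_(A in U) A = setT.

Definition menger (Z : topologicalType) : Prop :=
  forall U : nat -> set (set Z), (forall n, open_cover (U n)) ->
  exists V : nat -> set (set Z),
    (forall n, finite_set (V n) /\ V n `<=` U n) /\
    \bigcup_n \bigcup_(A in V n) A = setT.

(* set_type carries the subspace topology. *)
Definition menger_at_infinity (R : realType) (X : topologicalType) : Prop :=
  menger (set_type (stone_cech_remainder R X)).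

Definition countable_character (X : topologicalType) (Q : set X) : Prop :=
  exists B : set (set X), [/\ countable B,
    (forall V, B V -> open V /\ Q `<=` V) &
    (forall A, open A -> Q `<=` A -> exists2 V, B V & V `<=` A)].

Definition countable_type (X : topologicalType) : Prop :=
  forall K : set X, compact K ->
  exists Q : set X, [/\ compact Q, K `<=` Q & countable_character Q].

Definition closed_net (X : topologicalType) (K : set X) (F : set (set X)) :
    Prop :=
  (forall C, F C -> closed C /\ K `<=` C) /\
  (forall A, open A -> K `<=` A -> exists2 C, F C & C `<=` A).

(* Main.v *)
Require Import Defs.
From HB Require Import structures.
From mathcomp Require Import all_boot all_order all_algebra.
From mathcomp Require Import all_classical all_reals all_analysis.
Import numFieldNormedType.Exports.
Import Order.TTheory GRing.Theory Num.Theory.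

Set Implicit Arguments.
Unset Strict Implicit.
Unset Printing Implicit Defensive.

Local Open Scope classical_set_scope.

(* The argument works for any compact Hausdorff space C in which X is densely
   embedded, with remainder Z = C \ X.
   If Z is Menger: (i) cover Z by cozero sets of C missing a given compact K;
   countably many of them suffice, and their complement is a compact zero set,
   hence has countable character. (ii) If (F_p) is a closed net at the compact
   set K, the closures of the F_p in C meet only in K, so their complements
   form an increasing open cover of Z; the choice f given by the Menger property
   says that the closures of the F^n_f(n) meet inside X, and compactness of C
   does the rest.
   Conversely, given open covers U_n of Z by open sets of C, enlarge the compact
   set of points of C missed by U_n to a compact Q_n in X with a decreasing
   open base (B^n_p) and apply (ii) to the closures of the B^n_p. If O_n is
   open in C with trace B^n_f(n) on X, then finitely many members of U_n cover
   C \ O_n, and a point of Z in all O_n would, by density of X, contradict the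
   closed net property. *)

(** * Compactness, Menger subspaces and countable bases *)

Lemma open_finite_bigcap (T : topologicalType) (I : choiceType) (D : set I)
    (f : I -> set T) :
  finite_set D -> (forall i, D i -> open (f i)) -> open (\bigcap_(i in D) f i).
Proof.
move=> finD fop; rewrite -closedC setC_bigcap; apply: closed_bigcup => // i Di.
by rewrite closedC; exact: fop.
Qed.

(** If no finite subfamily covered, the sets [K] minus a finite union would generate a proper
    filter; a member of [U] around a cluster point of it gives a contradiction. *)
Lemma compact_finite_subcover (T : topologicalType) (K : set T)
    (U : set (set T)) :
  compact K -> U `<=` open -> K `<=` \bigcup_(A in U) A ->
  exists V, [/\ finite_set V, V `<=` U & K `<=` \bigcup_(A in V) A].
Proof.
move=> cK Uop KU; apply: contrapT => noV.
pose F := filter_from [set V | finite_set V /\ V `<=` U]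
  (fun V => K `\` \bigcup_(A in V) A).
have FF : ProperFilter F.
  apply: filter_from_proper.
    apply: filter_from_filter; first by exists set0; split.
    move=> V W [finV VU] [finW WU]; exists (V `|` W).
      by split; [rewrite finite_setU|rewrite subUset].
    by rewrite bigcup_setU setDUr.
  move=> V [finV VU]; apply/set0P/eqP => KV0.
  by apply: noV; exists V; split => //; rewrite -setD_eq0.
have FK : F K by exists set0; [split|move=> x []].
have [x [Kx clx]] := cK F FF FK.
have [A UA Ax] := KU x Kx.
have FA : F (K `\` A).
  exists [set A]; first by split => // _ ->.
  by rewrite bigcup_set1.
have nA : nbhs x A by apply: open_nbhs_nbhs; split => //; exact: Uop.
by have [y [[_ nAy] Ay]] := clx _ _ FA nA.
Qed.

(** The same filter argument: a cluster point of the sets [K] meet [D n] minus [A] lies in every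
    closed [D n], hence in the open [A], which the filter avoids. *)
Lemma compact_decreasing_closed (T : topologicalType) (K A : set T)
    (D : nat -> set T) :
  compact K -> (forall n, closed (D n)) ->
  (forall m n, (m <= n)%N -> D n `<=` D m) ->
  open A -> K `&` \bigcap_n D n `<=` A -> exists n, K `&` D n `<=` A.
Proof.
move=> cK Dcl Dmono Aop DA; apply: contrapT => noN.
pose F := filter_from setT (fun n => K `&` D n `\` A).
have FF : ProperFilter F.
  apply: filter_from_proper.
    apply: filter_from_filter; first by exists 0%N.
    move=> m n _ _; exists (maxn m n) => // x [[Kx Dx] nAx].
    by split; (do ?split) => //; apply: Dmono Dx;
      rewrite ?leq_maxl ?leq_maxr.
  move=> n _; apply/set0P/eqP => KDA; apply: noN; exists n => x KDx.
  by apply: contrapT => nAx; have : set0 x by rewrite -KDA.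
have FK : F K by exists 0%N => // x [[]].
have [x [Kx clx]] := cK F FF FK.
have Ax : A x.
  apply: DA; split => // n _; apply: Dcl => B nB.
  have FD : F (D n) by exists n => // y [[]].
  by have [y [Dy By]] := clx _ _ FD nB; exists y.
have FA : F (~` A) by exists 0%N => // y [].
have nA : nbhs x A by exact: open_nbhs_nbhs.
by have [y []] := clx _ _ FA nA.
Qed.

Lemma regular_compact_nbhs (T : topologicalType) (K A : set T) :
  regular_space T -> compact K -> open A -> K `<=` A ->
  exists W, [/\ open W, K `<=` W & closure W `<=` A].
Proof.
move=> regT cK Aop KA.
pose U := [set V : set T | open V /\ closure V `<=` A].
have KU : K `<=` \bigcup_(V in U) V.
  move=> x Kx; have [|B nB BA] := regT x A.
    by apply: open_nbhs_nbhs; split => //; exact: KA.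
  exists (interior B); last exact: nB.
  split; first exact: open_interior.
  by apply: subset_trans BA; apply: closureS; exact: interior_subset.
have [|V [finV VU KV]] := compact_finite_subcover cK _ KU; first by move=> ? [].
exists (\bigcup_(B in V) B); split => //.
  by apply: bigcup_open => B /VU [].
have /closure_id : closed (\bigcup_(B in V) closure B).
  by apply: closed_bigcup => // B _; exact: closed_closure.
move=> clV; apply: (@subset_trans _ (\bigcup_(B in V) closure B)).
  rewrite clV; apply: closureS => x [B VB Bx]; exists B => //.
  exact: subset_closure.
by move=> x [B /VU [_ BA] /BA].
Qed.

(** Trades relatively open covers for families of ambient open sets, so that later proofs need not
    handle the subspace topology. *)
Lemma menger_set_typeP (T : topologicalType) (Z : set T) :
  menger (set_type Z) <->
  forall U : nat -> set (set T),
    (forall n, U n `<=` open /\ Z `<=` \bigcup_(A in U n) A) ->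
    exists V : nat -> set (set T),
      (forall n, finite_set (V n) /\ V n `<=` U n) /\
      Z `<=` \bigcup_n \bigcup_(A in V n) A.
Proof.
split=> [mZ U Ucov|mZ U Ucov].
  pose pre (A : set T) : set (set_type Z) := set_val @^-1` A.
  have [|V [VU Vcov]] := mZ (fun n => pre @` U n).
    move=> n; have [Uop Un] := Ucov n; split.
      by move=> _ [A /Uop Aop <-]; exists A.
    rewrite -subTset => z _.
    have [A UA Az] := Un _ (set_valP z).
    by exists (pre A) => //; exists A.
  (* The lift depends on [n] as well as on the trace, since ambient sets with the same trace may
     belong to different [U n]; [set0] is only a default outside [V n]. *)
  have /choice [g gP] : forall nB : nat * set (set_type Z), exists A,
      V nB.1 nB.2 -> U nB.1 A /\ pre A = nB.2.
    move=> [n B]; have [|nVB] := pselect (V n B); last by exists set0.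
    by move=> /(VU n).2 [A UA AB]; exists A.
  exists (fun n => (fun B => g (n, B)) @` V n); split.
    move=> n; split; first by apply: finite_image; exact: (VU n).1.
    by move=> _ [B VB <-]; exact: (gP (n, B) VB).1.
  move=> z Zz; pose z' : set_type Z := SigSub (mem_set Zz).
  have [n _ [B VB Bz]] : (\bigcup_n \bigcup_(A in V n) A) z' by rewrite Vcov.
  exists n => //; exists (g (n, B)); first by exists B.
  by have [_ /= gB] := gP (n, B) VB; move: Bz; rewrite -[X in X z']gB.
pose W n := [set A : set T | open A /\ U n (set_val @^-1` A)].
have [|V [VW Vcov]] := mZ W.
  move=> n; split; first by move=> A [].
  move=> z Zz; pose z' : set_type Z := SigSub (mem_set Zz).
  have [Uop Un] := Ucov n.
  have [B UB Bz] : (\bigcup_(A in U n) A) z' by rewrite Un.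
  have [A Aop AB] := Uop _ UB.
  by exists A; [split => //; rewrite AB|have := Bz; rewrite -AB].
exists (fun n => (fun A : set T => set_val @^-1` A) @` V n); split.
  move=> n; split; first by apply: finite_image; exact: (VW n).1.
  by move=> _ [A VA <-]; exact: ((VW n).2 A VA).2.
rewrite -subTset => z _.
have [n _ [A VA Az]] := Vcov _ (set_valP z).
by exists n => //; exists (set_val @^-1` A) => //; exists A.
Qed.

(** Stage [n] intersects the finitely many members with code at most [n]. If there are none, the
    intersection is the whole space, which is harmless. *)
Lemma countable_character_decreasing {T : topologicalType} {Q : set T} :
  countable_character Q -> exists B : nat -> set T,
    [/\ (forall n, open (B n) /\ Q `<=` B n),
        (forall m n, (m <= n)%N -> B n `<=` B m) &
        (forall A, open A -> Q `<=` A -> exists n, B n `<=` A)].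
Proof.
move=> [D [/countable_injP [g ginj] DQ Dbase]].
pose I n := [set V | D V /\ (g V <= n)%N].
have Ifin n : finite_set (I n).
  have ginjI : {in I n &, injective g}.
    by move=> V W /set_mem [DV _] /set_mem [DW _]; apply: ginj; exact: mem_set.
  rewrite -(eq_finite_set (inj_card_eq ginjI)).
  by apply: (@sub_finite_set _ _ `I_n.+1) => // _ [V [_ ?] <-].
exists (fun n => \bigcap_(V in I n) V); split.
- move=> n; split; last by move=> x Qx V [/DQ [_ QV] _]; exact: QV.
  by apply: open_finite_bigcap => // V [/DQ []].
- by move=> m n mn x Bx V [DV Vm]; apply: Bx; split => //; exact: leq_trans mn.
- move=> A Aop QA; have [V DV VA] := Dbase A Aop QA.
  by exists (g V) => x Bx; apply: VA; apply: Bx; split.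
Qed.

Lemma increasing_finite_subset (T : Type) (G : nat -> set T) (V : set (set T)) :
  finite_set V -> (forall m n, (m <= n)%N -> G m `<=` G n) -> V `<=` range G ->
  exists n, \bigcup_(A in V) A `<=` G n.
Proof.
move=> /finite_seqP [s ->] Gmono.
elim: s => [|A s IHs] sG; first by exists 0%N => x [].
have [|n sn] := IHs; first by move=> B sB; apply: sG; rewrite /= inE sB orbT.
have [|m _ GmA] := sG A; first by rewrite /= mem_head.
exists (maxn m n) => x [B] /=; rewrite inE => /orP [/eqP ->|sB] Bx.
  by apply: (Gmono m); rewrite ?leq_maxl ?GmA.
by apply: (Gmono n); rewrite ?leq_maxr //; apply: sn; exists B.
Qed.

(** * Remainders in a compact closure of an embedded space *)

Section CompactificationRemainder.
Context {R : realType} {P X : topologicalType} {e : X -> P}.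
Hypothesis P_hausdorff : hausdorff_space P.
Hypothesis P_creg : completely_regular_space P.
Hypothesis e_cont : continuous e.
Hypothesis e_inducing :
  forall A : set X, open A -> exists2 B : set P, open B & A = e @^-1` B.
(** The compactification is kept as a subset of [P], so that open sets and separating functions live
    on [P]. *)
Let C := closure (range e).
Hypothesis C_compact : compact C.

Let Z := C `\` range e.

Lemma compact_image_embedding (K : set X) : compact K -> compact (e @` K).
Proof. by apply: continuous_compact; exact: continuous_subspaceT. Qed.

Lemma closed_image_embedding (K : set X) : compact K -> closed (e @` K).
Proof.
by move=> cK; apply: compact_closed => //; exact: compact_image_embedding.
Qed.

Lemma open_preimage_embedding (B : set P) : open B -> open (e @^-1` B).
Proof. by move=> oB; apply: open_comp => // x _; exact: e_cont. Qed.

(** The image filter clusters at some [e x] in [E]; as open sets of [X] are preimages, the original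
    filter clusters at [x]. *)
Lemma compact_preimage_embedding (E : set P) :
  compact E -> E `<=` range e -> compact (e @^-1` E).
Proof.
move=> cE Ee F FF FE.
have [y [Ey cly]] := cE (e @ F) _ FE.
have [x _ exy] := Ee y Ey.
exists x; split; first by rewrite /preimage /= exy.
move=> A B FA; rewrite nbhsE => -[G [oG Gx] GB].
have [G' oG' GG'] := e_inducing oG.
have FeA : F (e @^-1` (e @` A)) by apply: filterS FA => a Aa; exists a.
have nG' : nbhs y G'.
  by apply: open_nbhs_nbhs; split => //; rewrite -exy; move: Gx; rewrite GG'.
have [_ [[a Aa <-] G'a]] := cly _ _ FeA nG'.
by exists a; split => //; apply: GB; rewrite GG'.
Qed.

Lemma closed_preimage_closure_image (F : set X) (x : X) :
  closed F -> closure (e @` F) (e x) -> F x.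
Proof.
move=> Fcl clx; apply: contrapT => nFx.
have [B oB FB] := e_inducing (closed_openC Fcl).
have nB : nbhs (e x) B.
  by apply: open_nbhs_nbhs; split => //; have : (~` F) x by []; rewrite FB.
have [_ [[y Fy <-] By]] := clx _ nB.
by have : (~` F) y by rewrite FB.
Qed.

Lemma menger_remainder_countable_type :
  menger (set_type Z) -> countable_type X.
Proof.
move=> /menger_set_typeP mZ K cK.
(* Cozero sets are written as [f < 1] because the separating function is 0 at the given point and 1
   on the image of [K]. *)
pose U := [set A : set P | exists2 f : P -> R,
  continuous f /\ A = [set y | (f y < 1)%R] & e @` K `<=` ~` A].
have /choice [g gP] : forall A : set P, exists f : P -> R,
    U A -> continuous f /\ A = [set y | (f y < 1)%R].
  move=> A; have [[f fA _]|nUA] := pselect (U A); last by exists (fun=> 0%R).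
  by exists f.
(* With the constant sequence, the union of the finite [V n] is a countable subcover. *)
have [|V [VU ZV]] := mZ (fun=> U).
  move=> _; split.
    move=> A [f [fc ->] _].
    by apply: (@open_comp P R f [set r | (r < 1)%R]) => //; exact: open_lt.
  move=> z [_ nez].
  have /(@uniform_separatorP _ R) [f [fc _ f0 f1]] :
      uniform_separator [set z] (e @` K).
    apply: P_creg; first exact: closed_image_embedding.
    by move=> [x _ ez]; apply: nez; exists x.
  exists [set y | (f y < 1)%R]; last first.
    by rewrite /= (f0 (f z)) ?ltr01 //; exists z.
  exists f => // y eKy /=; rewrite (f1 (f y)) ?ltxx //; by exists y.
pose E := C `&` \bigcap_n \bigcap_(A in V n) ~` A.
have E_cl : closed (\bigcap_n \bigcap_(A in V n) ~` A).
  apply: closed_bigI => n _; apply: closed_bigI => A /(VU n).2 /gP [gc ->].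
  apply: open_closedC.
  by apply: (@open_comp P R (g A) [set r | (r < 1)%R]) => //; exact: open_lt.
have E_compact : compact E by exact: compact_closedI.
have E_range : E `<=` range e.
  move=> y [Cy nVy]; apply: contrapT => ney.
  by have [n _ [A VA Ay]] := ZV y (conj Cy ney); exact: (nVy n I A VA).
have KE : K `<=` e @^-1` E.
  move=> x Kx; split; first by apply: subset_closure; exists x.
  by move=> n _ A /(VU n).2 [f _ KA]; apply: KA; exists x.
(* Accumulating the families makes [D n] decrease while still involving finitely many functions. On
   [E] each chosen [g A] is at least 1, so the threshold [1 - 1/(n+1)] leaves room for the open set
   [O n] around [E]. *)
pose W n := \bigcup_(k in `I_n.+1) V k.
have WU n A : W n A -> U A by move=> [k _ /(VU k).2].
pose D n := \bigcap_(A in W n) [set y | (1 - n.+1%:R^-1 <= g A y)%R].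
pose O n := \bigcap_(A in W n) [set y | (1 - n.+1%:R^-1 < g A y)%R].
have O_open n : open (O n).
  apply: open_finite_bigcap.
    by apply: bigcup_finite => // k _; exact: (VU k).1.
  move=> A /WU /gP [gc _].
  by apply: (@open_comp P R (g A) [set r | (1 - n.+1%:R^-1 < r)%R]) => //;
    exact: open_gt.
have D_closed n : closed (D n).
  apply: closed_bigI => A /WU /gP [gc _].
  apply: (@preimage_closed P R (g A) [set r | (1 - n.+1%:R^-1 <= r)%R]);
    [by move=> y _; exact: gc|exact: closed_ge].
have D_mono m n : (m <= n)%N -> D n `<=` D m.
  move=> mn y Dy A [k km VA]; rewrite /= (@le_trans _ _ (1 - n.+1%:R^-1)%R) //.
    by rewrite lerD2l lerN2 lef_pV2 ?posrE ?ltr0n// ler_nat ltnS.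
  by apply: Dy; exists k => //; exact: leq_trans mn.
have EO n : E `<=` O n.
  move=> y [_ nVy] A WA; have [k _ VA] := WA.
  have := nVy k I A VA; rewrite /= {1}(gP A (WU _ _ WA)).2 => /negP.
  rewrite -leNgt; apply: lt_le_trans.
  by rewrite ltrBlDr ltrDl invr_gt0 ltr0n.
have DE : \bigcap_n D n `<=` \bigcap_n \bigcap_(A in V n) ~` A.
  move=> y Dy n _ A VA; rewrite (gP A ((VU n).2 A VA)).2 => /= gy1.
  have [m] := ltr_add_invr gy1; apply/negP; rewrite -leNgt -lerBlDr.
  (* The index [maxn m n] is large enough both for [A] to occur in [W] and for the threshold to
     exceed [g A y]. *)
  rewrite (@le_trans _ _ (1 - (maxn m n).+1%:R^-1)%R) //.
    by rewrite lerD2l lerN2 lef_pV2 ?posrE ?ltr0n// ler_nat ltnS leq_maxl.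
  by apply: (Dy (maxn m n) I); exists n => //=; rewrite ltnS leq_maxr.
exists (e @^-1` E); split => //; first exact: compact_preimage_embedding.
exists (range (fun n => e @^-1` O n)); split.
- exact: card_image_le.
- move=> _ [n _ <-]; split; first exact: open_preimage_embedding.
  by move=> x; exact: EO.
- move=> A oA EA; have [B oB AB] := e_inducing oA.
  have [|n Dn] := compact_decreasing_closed C_compact D_closed D_mono oB.
    move=> y [Cy /DE Vy]; have [x _ exy] := E_range y (conj Cy Vy).
    rewrite -exy -[B (e x)]/((e @^-1` B) x) -AB; apply: EA.
    by rewrite /preimage /= exy.
  exists (e @^-1` O n); first by exists n.
  move=> x Ox; rewrite AB; apply: Dn; split.
    by apply: subset_closure; exists x.
  by move=> A' WA'; apply: ltW; exact: Ox.
Qed.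

(** By regularity, a point off the image of [K] has a neighbourhood whose closure misses that image;
    some [F p] is mapped outside this closure. *)
Lemma closed_net_closure_image (K : set X) (F : nat -> set X) :
  compact K -> closed_net K (range F) ->
  \bigcap_p closure (e @` F p) `<=` e @` K.
Proof.
move=> cK [_ Fnet] y Fy; apply: contrapT => nKy.
have P_reg := @completely_regular_regular R P P_creg.
have [|B nB BK] := P_reg y (~` (e @` K)).
  apply: open_nbhs_nbhs; split => //.
  by apply: closed_openC; exact: closed_image_embedding.
have [||_ [p _ <-] Fp] := Fnet (e @^-1` (~` closure B)).
- by apply: open_preimage_embedding; apply: closed_openC; exact: closed_closure.
- by move=> x Kx /BK; apply; exists x.
have [_ [[x /Fp Fx <-] Bx]] := Fy p I _ nB.
by apply: Fx; exact: subset_closure.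
Qed.

Lemma menger_remainder_closed_nets
    (K : nat -> set X) (F : nat -> nat -> set X) :
  menger (set_type Z) ->
  (forall n, compact (K n)) ->
  (forall n p q, (p <= q)%N -> F n q `<=` F n p) ->
  (forall n, closed_net (K n) (range (F n))) ->
  exists f : nat -> nat,
    compact (\bigcap_n F n (f n)) /\
    closed_net (\bigcap_n F n (f n))
      (range (fun n => \bigcap_(k in [set k | (k <= n)%N]) F k (f k))).
Proof.
move=> /menger_set_typeP mZ cK Fmono Fnet.
have Fcl n p : closed (F n p) by apply: ((Fnet n).1 _ _).1; exists p.
pose G n p := ~` closure (e @` F n p).
have Gmono n p q : (p <= q)%N -> G n p `<=` G n q.
  move=> pq; apply: subsetC; apply: closureS; apply: image_subset.
  exact: Fmono.
have [|V [VU ZV]] := mZ (fun n => range (G n)).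
  move=> n; split.
    by move=> _ [p _ <-]; apply: closed_openC; exact: closed_closure.
  move=> z [_ nez]; apply: contrapT => nGz.
  have [] : (e @` K n) z.
    apply: (closed_net_closure_image (cK n) (Fnet n)) => p _.
    by apply: contrapT => nFz; apply: nGz; exists (G n p) => //; exists p.
  by move=> x _ ezx; apply: nez; exists x.
(* The [G n p] increase with [p], so a single one absorbs the finite family [V n]; its index becomes
   [f n]. *)
have /choice [f fP] : forall n, exists p, \bigcup_(A in V n) A `<=` G n p.
  move=> n; apply: increasing_finite_subset (VU n).1 (Gmono n) (VU n).2.
pose D n := \bigcap_(k in [set k | (k <= n)%N]) closure (e @` F k (f k)).
have D_closed n : closed (D n).
  by apply: closed_bigI => k _; exact: closed_closure.
have D_mono m n : (m <= n)%N -> D n `<=` D m.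
  by move=> mn y Dy k km; apply: Dy; exact: leq_trans mn.
pose E := C `&` \bigcap_n D n.
have E_range : E `<=` range e.
  move=> z [Cz Dz]; apply: contrapT => nez.
  have [n _ /fP Gz] := ZV z (conj Cz nez).
  by apply: Gz; exact: (Dz n I n (leqnn n)).
have E_compact : compact E.
  by apply: compact_closedI => //; exact: closed_bigI.
(* A closed set of [X] is the trace of the closure of its image, so pulling [E] back gives exactly
   the required intersection. *)
have EF : e @^-1` E = \bigcap_n F n (f n).
  apply/seteqP; split=> x.
    move=> [_ Dx] n _; apply: closed_preimage_closure_image => //.
    exact: (Dx n I n (leqnn n)).
  move=> Fx; split; first by apply: subset_closure; exists x.
  by move=> n _ k _; apply: subset_closure; exists x => //; exact: Fx.
exists f; rewrite -EF; split; first exact: compact_preimage_embedding.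
split.
  move=> _ [n _ <-]; split; first by apply: closed_bigI => k _.
  by rewrite EF => x Fx k _; exact: Fx.
move=> A oA EA; have [B oB AB] := e_inducing oA.
have [|n Dn] := compact_decreasing_closed C_compact D_closed D_mono oB.
  move=> y Ey; have [x _ exy] := E_range y Ey.
  rewrite -exy -[B (e x)]/((e @^-1` B) x) -AB; apply: EA.
  by rewrite /preimage /= exy.
exists (\bigcap_(k in [set k | (k <= n)%N]) F k (f k)); first by exists n.
move=> x Fx; rewrite AB; apply: Dn; split.
  by apply: subset_closure; exists x.
by move=> k kn; apply: subset_closure; exists x => //; exact: Fx.
Qed.

(** Closures enlarge the base sets, but regularity gives an open [W] around the image of [Q] with
    closure inside the target; a base set mapped into [W] has its closure there too. *)
Lemma closure_base_closed_net (Q : set X) (B : nat -> set X) :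
  compact Q -> (forall n, open (B n) /\ Q `<=` B n) ->
  (forall A, open A -> Q `<=` A -> exists n, B n `<=` A) ->
  closed_net Q (range (fun n => e @^-1` closure (e @` B n))).
Proof.
move=> cQ QB Bbase; split.
  move=> _ [n _ <-]; split.
    by apply: preimage_closed => [x _|]; [exact: e_cont|exact: closed_closure].
  by move=> x Qx; apply: subset_closure; exists x => //; exact: (QB n).2.
move=> A oA QA; have [A' oA' AA'] := e_inducing oA.
have [|W [ oW QW WA]] := regular_compact_nbhs
    (@completely_regular_regular R P P_creg) (compact_image_embedding cQ) oA'.
  by move=> _ [x /QA + <-]; rewrite AA'.
have [||n BW] := Bbase (e @^-1` W).
- exact: open_preimage_embedding.
- by move=> x Qx; apply: QW; exists x.
exists (e @^-1` closure (e @` B n)); first by exists n.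
rewrite AA' => x clx; apply: WA; apply: closureS clx.
by move=> _ [y /BW By <-].
Qed.

Lemma closed_nets_menger_remainder :
  countable_type X ->
  (forall (K : nat -> set X) (F : nat -> nat -> set X),
     (forall n, compact (K n)) ->
     (forall n p q, (p <= q)%N -> F n q `<=` F n p) ->
     (forall n, closed_net (K n) (range (F n))) ->
     exists f : nat -> nat,
       compact (\bigcap_n F n (f n)) /\
       closed_net (\bigcap_n F n (f n))
         (range (fun n => \bigcap_(k in [set k | (k <= n)%N]) F k (f k)))) ->
  menger (set_type Z).
Proof.
move=> ctX netX; apply/menger_set_typeP => U Ucov.
have C_closed : closed C by exact: closed_closure.
(* Since [U n] covers the remainder, the points of [C] it misses form a compact set inside the image
   of [X]. *)
have UK n : exists Q, [/\ compact Q,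
    e @^-1` (C `\` \bigcup_(A in U n) A) `<=` Q & countable_character Q].
  apply: ctX; apply: compact_preimage_embedding.
    apply: compact_closedI => //; apply: open_closedC.
    by apply: bigcup_open => A /(Ucov n).1.
  move=> y [Cy nUy]; apply: contrapT => ney; apply: nUy.
  exact: (Ucov n).2.
have [Q QP] := choice UK.
have Bex n : exists B : nat -> set X,
    [/\ (forall p, open (B p) /\ Q n `<=` B p),
        (forall p q, (p <= q)%N -> B q `<=` B p) &
        (forall A, open A -> Q n `<=` A -> exists p, B p `<=` A)].
  by have [_ _ /countable_character_decreasing] := QP n.
have [B BP] := choice Bex.
pose F n p := e @^-1` closure (e @` B n p).
have [| |n|f [Kf_compact [_ Kf_net]]] := netX Q F.
- by move=> n; have [] := QP n.
- move=> n p q pq x; apply: closureS; apply: image_subset.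
  by have [_ + _] := BP n; apply.
- have [cQ _ _] := QP n; have [? _ ?] := BP n.
  exact: closure_base_closed_net.
have Oex n : exists O, open O /\ B n (f n) = e @^-1` O.
  have [/(_ (f n)) [ oB _] _ _] := BP n.
  by have [G oG BG] := e_inducing oB; exists G.
have [ O OP] := choice Oex.
(* A point of [C] missed by [U n] comes from [Q n], hence lies in [O n]; so [U n] covers the compact
   set [C] minus [O n]. *)
have Vex n : exists V, [/\ finite_set V, V `<=` U n &
    C `\` O n `<=` \bigcup_(A in V) A].
  apply: compact_finite_subcover => //.
  - by apply: compact_closedI => //; apply: open_closedC; exact: (OP n).1.
  - exact: (Ucov n).1.
  - move=> y [Cy nOy]; apply: contrapT => nUy.
    have [x _ exy] : range e y.
      by apply: contrapT => ney; apply: nUy; exact: (Ucov n).2.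
    have [_ UQ _] := QP n; have [/(_ (f n)) [_ QB] _ _] := BP n.
    apply: nOy; rewrite -exy -[ O n (e x)]/((e @^-1` O n) x) -(OP n).2.
    by apply/QB/UQ; rewrite /preimage /= exy.
have [V VP] := choice Vex.
exists V; split; first by move=> n; have [] := VP n.
move=> z [Cz nez]; apply: contrapT => nVz.
have Oz n : O n z.
  apply: contrapT => nOz; apply: nVz; have [_ _ OV] := VP n.
  by exists n => //; exact: OV.
pose K := \bigcap_n F n (f n).
have [|N nN NK] := @completely_regular_regular R P P_creg z (~` (e @` K)).
  apply: open_nbhs_nbhs; split.
    by apply: closed_openC; exact: closed_image_embedding.
  by move=> [x _ ez]; apply: nez; exists x.
have [||_ [n _ <-] Fn] := Kf_net (e @^-1` (~` closure N)).
- by apply: open_preimage_embedding; apply: closed_openC; exact: closed_closure.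
- by move=> x Kx /NK; apply; exists x.
(* By density this neighbourhood contains some [e x]. Then [x] lies in [B k (f k)] for all [k <= n],
   hence in the net member, which is mapped outside the closure of [N], although [e x] is in [N]. *)
have nG : nbhs z (N `&` \bigcap_(k in `I_n.+1) O k).
  apply: filterI => //; apply: open_nbhs_nbhs; split.
    by apply: open_finite_bigcap => // k _; exact: (OP k).1.
  by move=> k _; exact: Oz.
have [_ [[x _ <-] [Nx Ox]]] := Cz _ nG.
apply: (Fn x); last exact: subset_closure.
move=> k kn; apply: subset_closure; exists x => //.
by rewrite (OP k).2; apply: Ox.
Qed.

End CompactificationRemainder.

(** * The evaluation map into the Tychonoff cube *)

Section StoneCechEmbedding.
Context {R : realType} {X : topologicalType}.
Let P := {ptws @unit_fun R X -> R}.
Let e : X -> P := @stone_cech_eval R X.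

Lemma unit_fun_eval_continuous (f : @unit_fun R X) :
  continuous (fun g : P => g f).
Proof. exact: (@proj_continuous {classic (@unit_fun R X)} (fun=> R) f). Qed.

Lemma stone_cech_eval_continuous : continuous e.
Proof.
move=> x; apply/cvg_sup => f.
move: x; apply/(@continuousP _ (initial_topology (fun g : P => g f))).
move=> _ [B Bop <-].
exact: (open_comp (fun x _ => (svalP f).1 x) Bop).
Qed.

Lemma stone_cech_hausdorff : hausdorff_space P.
Proof.
apply: (@hausdorff_product {classic (@unit_fun R X)} (fun=> R)) => _.
exact: order_hausdorff.
Qed.

(** The cube is compact by Tychonoff's theorem, hence closed in the Hausdorff product, so it
    contains the closure of the image. *)
Lemma compact_stone_cech : compact (stone_cech R X).
Proof.
have cube : compact [set g : P | forall f, `[0%R, 1%R]%classic (g f)].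
  apply: (@tychonoff {classic (@unit_fun R X)} (fun=> R)
    (fun=> `[0%R, 1%R]%classic)) => _.
  exact: segment_compact.
apply: (subclosed_compact _ cube); first exact: closed_closure.
have /closure_id -> := compact_closed stone_cech_hausdorff cube.
by apply: closureS => _ [x _ <-] f; apply: (svalP f).2; exists x.
Qed.

(** Complete regularity gives, at each point of [A], a coordinate that is 0 there and 1 off [A]; the
    half-spaces [g f < 1] over coordinates equal to 1 off [A] therefore have union with trace
    [A]. *)
Lemma stone_cech_eval_inducing (A : set X) :
  completely_regular_space X -> open A ->
  exists2 B : set P, open B & A = e @^-1` B.
Proof.
move=> regX Aop.
pose D := [set f : @unit_fun R X | forall x, ~ A x -> sval f x = 1%R].
exists (\bigcup_(f in D) [set g : P | (g f < 1)%R]).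
  apply: bigcup_open => f _.
  apply: (@open_comp P R (fun g : P => g f) [set r | (r < 1)%R]) => [g _|];
    last exact: open_lt.
  exact: unit_fun_eval_continuous.
apply/seteqP; split => x; last first.
  move=> [f Df /= fx]; apply: contrapT => /Df fx1; move: fx.
  by rewrite /e /stone_cech_eval fx1 ltxx.
move=> Ax.
have /(@uniform_separatorP _ R) [f [fcont f01 f0 f1]] :
    uniform_separator [set x] (~` A).
  by apply: regX => //; exact: open_closedC.
exists (exist _ f (conj fcont f01)) => /=.
  by move=> y nAy; apply: f1; exists y.
by rewrite /e /stone_cech_eval /= (f0 (f x)) ?ltr01 //; exists x.
Qed.

End StoneCechEmbedding.

Theorem theorem2p5 (R : realType) (X : topologicalType)
    (tychX : tychonoff_space X) :
  menger_at_infinity R X <->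
  (countable_type X /\
   forall (K : nat -> set X) (F : nat -> nat -> set X),
     (forall n, compact (K n)) ->
     (forall n p q, (p <= q)%N -> F n q `<=` F n p) ->
     (forall n, closed_net (K n) (range (F n))) ->
     exists f : nat -> nat,
       compact (\bigcap_n F n (f n)) /\
       closed_net (\bigcap_n F n (f n))
         (range (fun n => \bigcap_(k in [set k | (k <= n)%N]) F k (f k)))).
Proof.
have [_ cregX] := tychX.
have P_hausdorff := @stone_cech_hausdorff R X.
(* The product carries a uniformity, which yields complete regularity. *)
have P_creg : completely_regular_space {ptws @unit_fun R X -> R} :=
  @uniform_completely_regular R _.
have e_cont := @stone_cech_eval_continuous R X.
have e_inducing := fun A => @stone_cech_eval_inducing R X A cregX.
have C_compact := @compact_stone_cech R X.
split=> [mX|[ctX netX]].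
  split; first exact: (menger_remainder_countable_type P_hausdorff P_creg).
  move=> K F; exact: (menger_remainder_closed_nets P_hausdorff P_creg).
exact: (closed_nets_menger_remainder P_hausdorff P_creg).
Qed.
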